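(* The category $\mathbf{PAKF}$ of perfect augmented Kripke frames and paK-functions is a proper subcategory of the category $\mathbf{mKF}$ of mk-frames and mk-functions; that is, every perfect augmented Kripke frame $(X,\Omega,R,E)$ is an mk-frame $(X,\Omega,R,E)$ (with $R$ as the order), every paK-function between perfect augmented Kripke frames is an mk-function, and not every mk-frame is a perfect augmented Kripke frame.
   Context: Relation notation: for $R\subseteq X\times X$, $R(Z)=\{y:(x,y)\in R$ for some $x\in Z\}$, $R(x)=R(\{x\})$, $R^{-1}(V)=\{x: R(x)\cap V\neq\emptyset\}$; the composition $R\circ T$ is $\{(x,y): \exists z\,((x,z)\in T,\ (z,y)\in R)\}$. In a poset $(Y]$ and $[Y)$ are the down- and up-sets generated by $Y$, $[x)=[\{x\})$. A perfect augmented Kripke frame (paK-frame) is $(X,\Omega,R,E)$ such that: $(X,R)$ is a nonempty poset, $E$ is an equivalence relation on $X$, $R\circ E\subseteq E\circ R$; for $T=R$ and for $T=E\circ R$: $(X,T)$ is a nonempty quasi-ordered set, $(X,\Omega)$ is a Stone space (compact, Hausdorff, zero-dimensional), $T(x)$ is closed for all $x$, and $T^{-1}(A)$ is clopen for every clopen $A$; and $E(A)$ is clopen for every $R$-increasing clopen $A$. A paK-function $f:(X_1,\Omega_1,R_1,E_1)\to(X_2,\Omega_2,R_2,E_2)$ is a continuous map such that for $(T_1,T_2)=(R_1,R_2)$ and $(T_1,T_2)=(E_1\circ R_1,E_2\circ R_2)$: $(f(x),y)\in T_2$ iff there is $z$ with $(x,z)\in T_1$ and $f(z)=y$; and $(f(x),y)\in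 E_2$ iff there is $z$ with $(x,z)\in E_1$ and $(y,f(z))\in R_2$. A Priestley space is a compact space with a partial order such that whenever $x\not\le y$ there is a clopen increasing $U$ with $x\in U$, $y\notin U$; $D(X)$ is the set of clopen increasing subsets. An mk-frame is $(X,\Omega,\le,E)$ where $(X,\le)$ is a nonempty poset, $E$ an equivalence relation, and: (mk1) $\le\circ E\subseteq E\circ\le$; (mk2) $(X,\Omega,\le)$ is a Priestley space; (mk3) $E(A)$ is closed for all closed $A$; (mk4) $E(U)$ is open for all $U\in D(X)$; (mk5) $(E(X\setminus U)]$ is open for all $U\in D(X)$. An mk-function is an order-preserving continuous map $f$ with (mkf1) $(x,y)\in E_1\Rightarrow (f(x),f(y))\in E_2$; (mkf2) $E_2(f(x))\subseteq(f(E_1(x))]$; (mkf3) $E_2([f(x)))\subseteq[f(E_1([x))))$ for all $x$. *)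

(* Defs.v *)
From Corelib Require Relation_Definitions.
From mathcomp Require Import all_boot all_order.
From mathcomp Require Import all_classical.
From mathcomp Require Import topology.

Set Implicit Arguments.
Unset Strict Implicit.
Unset Printing Implicit Defensive.

Local Open Scope classical_set_scope.
Local Open Scope relation_scope.

(* A relation R on X is a subset of X * X.  The library's composition
   B \; A = [set xy | exists2 z, A (xy.1, z) & B (z, xy.2)] applies A first, so
   E \; R is E o R: follow R, then E. *)

Definition is_poset (X : Type) (R : set (X * X)) : Prop :=
  [set: X] !=set0 /\ Relation_Definitions.order X (curry R).

Definition is_qoset (X : Type) (R : set (X * X)) : Prop :=
  [set: X] !=set0 /\ Relation_Definitions.preorder X (curry R).

Definition is_equiv (X : Type) (E : set (X * X)) : Prop :=
  Relation_Definitions.equivalence X (curry E).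

Definition rel_image (X : Type) (R : set (X * X)) (Z : set X) : set X :=
  [set y | exists2 x, Z x & R (x, y)].

Definition rel_section (X : Type) (R : set (X * X)) (x : X) : set X :=
  rel_image R [set x].

Definition rel_preimage (X : Type) (R : set (X * X)) (V : set X) : set X :=
  [set x | (rel_section R x `&` V) !=set0].

Definition down_set (X : Type) (R : set (X * X)) (Y : set X) : set X :=
  [set x | exists2 y, Y y & R (x, y)].

Definition up_set (X : Type) (R : set (X * X)) (Y : set X) : set X :=
  [set x | exists2 y, Y y & R (y, x)].

Definition increasing (X : Type) (R : set (X * X)) (U : set X) : Prop :=
  forall x y, U x -> R (x, y) -> U y.

(* The library's zero_dimensional only asks that distinct points be separated
   by clopen sets; here the clopen sets are required to form a basis. *)
Definition stone_space (X : topologicalType) : Prop :=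
  [/\ compact [set: X], hausdorff_space X & basis (@clopen X)].

Definition perfect_kripke_frame (X : topologicalType) (T : set (X * X)) : Prop :=
  [/\ is_qoset T,
      stone_space X,
      forall x : X, closed (rel_section T x) &
      forall A : set X, clopen A -> clopen (rel_preimage T A)].

Record paK_frame (X : topologicalType) (R E : set (X * X)) : Prop := PaKFrame {
  paK_poset : is_poset R ;
  paK_equiv : is_equiv E ;
  paK_comp : R \; E `<=` E \; R ;
  paK_perfect : perfect_kripke_frame R ;
  paK_perfect_comp : perfect_kripke_frame (E \; R) ;
  paK_clopen : forall A : set X,
    increasing R A -> clopen A -> clopen (rel_image E A)
}.

Definition back_and_forth (X1 X2 : Type) (T1 : set (X1 * X1))
    (T2 : set (X2 * X2)) (f : X1 -> X2) : Prop :=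
  forall x y, T2 (f x, y) <-> exists z, T1 (x, z) /\ f z = y.

Record paK_function (X1 X2 : topologicalType) (R1 E1 : set (X1 * X1))
    (R2 E2 : set (X2 * X2)) (f : X1 -> X2) : Prop := PaKFunction {
  paKf_continuous : continuous f ;
  paKf_order : back_and_forth R1 R2 f ;
  paKf_comp : back_and_forth (E1 \; R1) (E2 \; R2) f ;
  paKf_equiv : forall x y,
    E2 (f x, y) <-> exists z, E1 (x, z) /\ R2 (y, f z)
}.

Definition clopen_increasing (X : topologicalType) (R : set (X * X)) :
    set (set X) :=
  [set U | clopen U /\ increasing R U].

Definition priestley_space (X : topologicalType) (R : set (X * X)) : Prop :=
  [/\ compact [set: X],
      Relation_Definitions.order X (curry R) &
      forall x y : X, ~ R (x, y) ->
        exists U : set X, [/\ clopen_increasing R U, U x & ~ U y]].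

Record mk_frame (X : topologicalType) (R E : set (X * X)) : Prop := MkFrame {
  mk_poset : is_poset R ;
  mk_equiv : is_equiv E ;
  mk1 : R \; E `<=` E \; R ;
  mk2 : priestley_space R ;
  mk3 : forall A : set X, closed A -> closed (rel_image E A) ;
  mk4 : forall U : set X, clopen_increasing R U -> open (rel_image E U) ;
  mk5 : forall U : set X, clopen_increasing R U ->
    open (down_set R (rel_image E (~` U)))
}.

Record mk_function (X1 X2 : topologicalType) (R1 E1 : set (X1 * X1))
    (R2 E2 : set (X2 * X2)) (f : X1 -> X2) : Prop := MkFunction {
  mkf_order : forall x y, R1 (x, y) -> R2 (f x, f y) ;
  mkf_continuous : continuous f ;
  mkf1 : forall x y, E1 (x, y) -> E2 (f x, f y) ;
  mkf2 : forall x,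
    rel_section E2 (f x) `<=` down_set R2 (f @` rel_section E1 x) ;
  mkf3 : forall x,
    rel_image E2 (up_set R2 [set f x]) `<=`
      up_set R2 (f @` rel_image E1 (up_set R1 [set x]))
}.

(* Main.v *)
Require Import Defs.
From mathcomp Require Import all_boot all_order.
From mathcomp Require Import all_classical.
From mathcomp Require Import topology.
From mathcomp Require Import cantor.

Set Implicit Arguments.
Unset Strict Implicit.
Unset Printing Implicit Defensive.

(** In a perfect augmented Kripke frame put T := E o R.  The relation T is
    closed, because points outside T(x) are separated from x by clopen sets
    and their T-preimages.  The key fact is E = T `&` T^-1: the T-cluster C of
    a point is closed, so it has an R-maximal element m, and from
    m R z E y with y in C one gets z in C, hence z = m and m E y.  Thus E is a
    closed relation on a compact Hausdorff space and maps closed sets to closed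
    sets; the remaining mk-axioms are immediate, since (E(A)] = T^-1(A).

    The inclusion is proper because an mk-frame need not be an Esakia space: on
    the Cantor space, let E be equality and let the only strict inequality be
    p < q.  For a clopen A containing q but not p the R-preimage of A is
    A `|` [set p], which is not open as p is not isolated. *)

Local Open Scope classical_set_scope.
Local Open Scope relation_scope.

(** * Images, sections and preimages of relations *)

Lemma rel_sectionP (X : Type) (R : set (X * X)) (x : X) :
  rel_section R x = [set y | R (x, y)].
Proof. by apply/seteqP; split=> y; [case=> _ -> | exists x]. Qed.

Lemma rel_preimageP (X : Type) (R : set (X * X)) (A : set X) :
  rel_preimage R A = down_set R A.
Proof.
rewrite /rel_preimage; apply/seteqP; split=> x.
  by case=> y []; rewrite rel_sectionP => Rxy Ay; exists y.
by case=> y Ay Rxy; exists y; split=> //; rewrite rel_sectionP.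
Qed.

(** Symmetry of [E] lets the image be read backwards; this reduces [mk5] to preimages of clopen sets
    under [E \; R]. *)
Lemma down_set_rel_image (X : Type) (R E : set (X * X)) (A : set X) :
  is_equiv E -> down_set R (rel_image E A) = rel_preimage (E \; R) A.
Proof.
case=> _ _ Esym; rewrite rel_preimageP; apply/seteqP; split=> x.
  by case=> z [y Ay Eyz] Rxz; exists y => //; exists z => //; exact: Esym.
by case=> y Ay [z Rxz Ezy]; exists z => //; exists y => //; exact: Esym.
Qed.

(** * Clopen separation and closed relations *)

Lemma stone_clopen_separation (X : topologicalType) (A : set X) (y : X) :
  stone_space X -> closed A -> ~ A y ->
  exists V, [/\ clopen V, V y & A `&` V = set0].
Proof.
move=> [_ _ [_ basisX]] clA nAy.
have /basisX[V [clV Vy] VA] : nbhs y (~` A).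
  by apply: open_nbhs_nbhs; split=> //; exact: closed_openC.
by exists V; split=> //; apply/seteqP; split=> // z [Az /VA].
Qed.

Lemma perfect_kripke_separation (X : topologicalType) (T : set (X * X))
    (x y : X) : perfect_kripke_frame T -> ~ T (x, y) ->
  exists V, [/\ clopen V, V y & ~ rel_preimage T V x].
Proof.
move=> [_ stX clT _] nTxy.
have [|V [clV Vy TV0]] := stone_clopen_separation stX (clT x) (y := y).
  by rewrite rel_sectionP.
by exists V; split=> // -[z TVz]; rewrite TV0 in TVz.
Qed.

Lemma clopenC_clopen (X : topologicalType) (A : set X) :
  clopen A -> clopen (~` A).
Proof. by case=> oA cA; split; [exact: closed_openC | exact: open_closedC]. Qed.

Lemma perfect_kripke_closed (X : topologicalType) (T : set (X * X)) :
  perfect_kripke_frame T -> closed T.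
Proof.
move=> kT [x y] clTxy; apply: contrapT => nTxy.
have [V [clV Vy nx]] := perfect_kripke_separation kT nTxy.
case: (kT) => _ _ _ /(_ _ clV)/clopenC_clopen[oP _].
(* This open rectangle is a neighbourhood of [(x, y)] that misses [T]. *)
have [|[a b] [Tab [/= na Vb]]] := clTxy ((~` rel_preimage T V) `*` V).
  exists (~` rel_preimage T V, V) => //=.
  by split; apply: open_nbhs_nbhs; split=> //; case: clV.
by apply: na; rewrite rel_preimageP; exists b.
Qed.

Lemma closed_converse (X : topologicalType) (T : set (X * X)) :
  closed T -> closed [set xy | T (xy.2, xy.1)].
Proof.
apply: (@preimage_closed _ _ (fun xy : X * X => (xy.2, xy.1))) => z _.
by apply: cvg_pair; [exact: cvg_snd | exact: cvg_fst].
Qed.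

(** * Maximal points, and closedness of [E] *)

Lemma closed_has_maximal (X : topologicalType) (R : set (X * X)) (C : set X) :
  compact [set: X] -> Relation_Definitions.order X (curry R) ->
  (forall x, closed (rel_section R x)) -> closed C -> C !=set0 ->
  exists2 m, C m & forall y, C y -> R (m, y) -> y = m.
Proof.
move=> cX [Rrefl Rtrans Ranti] clR clC [c0 Cc0].
have cC : compact C by exact: subclosed_compact clC cX _.
(* [Zorn] speaks of a whole type with a boolean relation, hence the subtype of [C]. *)
pose r (s t : {x | C x}) := `[< R (sval s, sval t) >].
have [||||[m Cm] maxm] := @Zorn {x | C x} r.
- by move=> s; apply/asboolP; exact: Rrefl.
- by move=> s t u /asboolP st /asboolP tu; apply/asboolP; exact: Rtrans st tu.
- move=> [s Cs] [t Ct] /asboolP st /asboolP ts; apply: eq_exist.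
  exact: Ranti st ts.
- move=> A totA; have [[a Aa]|A0] := pselect (A !=set0); last first.
    by exists (exist _ c0 Cc0) => s As; case: A0; exists s.
  (* Since [A] is a nonempty chain, these sets form a filter base. By compactness of [C] there is a
     cluster point in [C]; it lies in each closed section, so it bounds the chain. *)
  pose F := filter_from A (fun s => C `&` rel_section R (sval s)).
  have FF : ProperFilter F.
    apply: filter_from_proper.
      apply: filter_from_filter; first by exists a.
      move=> s t As At; have [/asboolP rst|/asboolP rst] := totA s t As At.
        exists t => // z [Cz]; rewrite !rel_sectionP => Rtz.
        by split; split=> //; exact: (Rtrans _ _ _ rst Rtz).
      exists s => // z [Cz]; rewrite !rel_sectionP => Rsz.
      by split; split=> //; exact: (Rtrans _ _ _ rst Rsz).
    move=> [s Cs] As; exists s; split=> //=; rewrite rel_sectionP; exact: Rrefl.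
  have [|t [Ct clt]] := cC F FF; first by exists a => // z [].
  exists (exist _ t Ct) => s As; apply/asboolP => /=.
  suff : rel_section R (sval s) t by rewrite rel_sectionP.
  by apply: clR => B nB; apply: clt nB; exists s => // z [].
exists m => // y Cy Rmy.
by have /(congr1 sval) : exist _ y Cy = exist _ m Cm by apply/maxm/asboolP.
Qed.

Lemma paK_equivE (X : topologicalType) (R E : set (X * X)) :
  paK_frame R E -> E = (E \; R) `&` [set xy | (E \; R) (xy.2, xy.1)].
Proof.
move=> [[_ [Rrefl Rtrans Ranti]] [Erefl Etrans Esym] _ kR kT _].
have ET x y : E (x, y) -> (E \; R) (x, y).
  by move=> Exy; exists x => //; exact: Rrefl.
apply/seteqP; split=> [[x y] Exy|[x y] [Txy Tyx]].
  by split; apply: ET => //; exact: Esym.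
case: (kR) => _ [cX hX _] clR _; case: (kT) => -[_ [_ Ttrans]] _ clT _.
pose C := [set z | (E \; R) (x, z) /\ (E \; R) (z, x)].
have clC : closed C.
  (* [C] is the fibre over [x] of a closed relation. *)
  have -> : C = (fun z => (x, z)) @^-1`
      ((E \; R) `&` [set xy | (E \; R) (xy.2, xy.1)]) by [].
  apply: preimage_closed => [z _|].
    by apply: cvg_pair => //=; exact: cvg_cst.
  apply: closedI; first exact: perfect_kripke_closed.
  by apply: closed_converse; exact: perfect_kripke_closed.
have [||m [Txm Tmx] maxm] := closed_has_maximal cX _ clR clC; first by [].
  by exists x; split; apply: ET; exact: Erefl.
have mE z : C z -> E (m, z).
  move=> [Txz Tzx].
  have [w Rmw Ewz] : (E \; R) (m, z) by exact: Ttrans Tmx Txz.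
  suff <- : w = m by [].
  (* The point [w] is in the cluster: [E] links it to [z], which is in [C], and [E] is contained in
     the transitive relation [E \; R]. *)
  apply: maxm => //; split.
    by apply: Ttrans Txz _; apply: ET; exact: Esym.
  by apply: Ttrans Tzx; exact: ET.
have Emx : E (m, x) by apply: mE; split; apply: ET; exact: Erefl.
by apply: (Etrans _ m); [exact: Esym | apply: mE].
Qed.

Lemma paK_equiv_closed (X : topologicalType) (R E : set (X * X)) :
  paK_frame R E -> closed E.
Proof.
move=> fX; rewrite (paK_equivE fX).
have clT := perfect_kripke_closed (paK_perfect_comp fX).
by apply: closedI => //; exact: closed_converse.
Qed.

(** The image is the second projection of a closed, hence compact, part of [X * X]; compact sets are
    closed in a Hausdorff space. *)
Lemma closed_rel_image (X : topologicalType) (E : set (X * X)) (A : set X) :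
  compact [set: X] -> hausdorff_space X -> closed E -> closed A ->
  closed (rel_image E A).
Proof.
move=> cX hX clE clA.
have -> : rel_image E A = snd @` (E `&` (fst @^-1` A)).
  apply/seteqP; split=> y.
    by case=> x Ax Exy; exists (x, y).
  by case=> -[x z] [Exz Ax] /= <-; exists x.
apply: compact_closed => //; apply: continuous_compact.
  by apply: continuous_subspaceT => z; exact: cvg_snd.
apply: (@subclosed_compact _ _ [set: X * X]) => //.
  apply: closedI => //; apply: preimage_closed => // z _; exact: cvg_fst.
by rewrite -setXTT; exact: compact_setX.
Qed.

(** * The inclusion on frames and on functions *)

Lemma perfect_kripke_priestley (X : topologicalType) (R : set (X * X)) :
  Relation_Definitions.order X (curry R) -> perfect_kripke_frame R ->
  priestley_space R.
Proof.
move=> oR kR; case: (oR) => Rrefl Rtrans _; case: (kR) => _ [cX _ _] _ preR; split=> // x y nRxy.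
have [V [clV Vy nx]] := perfect_kripke_separation kR nRxy.
(* Transitivity makes this complement increasing; reflexivity at [y] keeps [y] out of it. *)
exists (~` rel_preimage R V); split=> //; last first.
  by apply; rewrite rel_preimageP; exists y => //; exact: Rrefl.
split; first exact/clopenC_clopen/preR.
move=> a b; rewrite rel_preimageP => na Rab [c Vc Rbc].
by apply: na; exists c => //; exact: Rtrans Rab Rbc.
Qed.

Lemma paK_frame_mk_frame (X : topologicalType) (R E : set (X * X)) :
  paK_frame R E -> mk_frame R E.
Proof.
move=> fX; case: (fX) => -[X0 oR] eE comm kR kT clopenE.
case: (kR) => _ [cX hX _] _ _.
split=> //.
- exact: perfect_kripke_priestley.
- by move=> A; apply: closed_rel_image => //; exact: paK_equiv_closed fX.
- by move=> U [clU incU]; case: (clopenE U incU clU).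
- move=> U [clU _]; rewrite down_set_rel_image //.
  by case: kT => _ _ _ /(_ _ (clopenC_clopen clU))[].
Qed.

Lemma paK_function_mk_function (X1 X2 : topologicalType)
    (R1 E1 : set (X1 * X1)) (R2 E2 : set (X2 * X2)) (f : X1 -> X2) :
  is_poset R2 -> paK_function R1 E1 R2 E2 f -> mk_function R1 E1 R2 E2 f.
Proof.
move=> [_ [Rrefl _ _]] [cf fR fT fE]; split=> //.
- by move=> x y Rxy; apply/fR; exists y.
- by move=> x y Exy; apply/fE; exists y; split=> //; exact: Rrefl.
- move=> x y; rewrite rel_sectionP => /fE[z [Exz Ryz]].
  by exists (f z) => //; exists z => //; rewrite rel_sectionP.
- move=> x y [z [_ -> Rxz] Ezy].
  (* The condition on [E \; R] gives a point mapped exactly to [y], so the up-set in [mkf3] is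
     entered by reflexivity. *)
  have /fT[w [[v Rxv Evw] fwy]] : (E2 \; R2) (f x, y) by exists z.
  exists y; last exact: Rrefl.
  by exists w => //; exists v => //; exists x.
Qed.

(** * Properness: an order with a single strict pair *)

Definition one_strict_pair (X : Type) (p q : X) : set (X * X) :=
  [set xy | xy.1 = xy.2 \/ xy = (p, q)].

Lemma one_strict_pair_order (X : eqType) (p q : X) :
  p != q -> Relation_Definitions.order X (curry (one_strict_pair p q)).
Proof.
move=> pq; split.
- by move=> x; left.
- by move=> x y z [/= -> //|[-> ->]] [/= <-|[_ ->]]; right.
- move=> x y [//|[-> ->]] [//|[qp _]].
  by rewrite qp eqxx in pq.
Qed.

(** A set is increasing unless it contains [p] but not [q]. A clopen set separating [x] from [y] is
    therefore enlarged around [q] when [x = p], and otherwise shrunk to avoid [p]. *)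
Lemma one_strict_pair_priestley (X : topologicalType) (p q : X) :
  compact [set: X] -> zero_dimensional X -> p != q ->
  priestley_space (one_strict_pair p q).
Proof.
move=> cX zX pq; split=> //; first exact: one_strict_pair_order.
move=> x y nRxy.
have xy : x != y by apply/eqP => xy; apply: nRxy; left.
have [U [clU Ux nUy]] := zX _ _ xy.
have [xp|xp] := eqVneq x p.
  have qy : q != y.
    by apply/eqP => qy; apply: nRxy; right; rewrite xp qy.
  have [V [clV Vq nVy]] := zX _ _ qy.
  exists (U `|` V); split; [|by left|by case].
  split.
    by case: clU clV => oU cU [oV cV]; split; [exact: openU | exact: closedU].
  by move=> a b UVa [/= <- //|[_ ->]]; right.
have [V [clV Vx nVp]] := zX _ _ xp.
exists (U `&` V); split; [|by []|by case].
split; first exact: clopenI.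
by move=> a b UVa [/= <- //|[ap _]]; case: UVa => _; rewrite ap.
Qed.

Lemma one_strict_pair_mk_frame (X : topologicalType) (p q : X) :
  compact [set: X] -> zero_dimensional X -> p != q ->
  mk_frame (one_strict_pair p q) diagonal.
Proof.
move=> cX zX pq.
have imE A : rel_image diagonal A = A.
  by apply/seteqP; split=> [x [y Ay /diagonalP <-]|x Ax] //; exists x.
split=> //.
- by split; [exists p | exact: one_strict_pair_order].
- by split=> [x|x y z|x y] //; rewrite /curry /diagonal /= => ->.
- by move=> [x y] [z /diagonalP /= -> Rzy]; exists y.
- exact: one_strict_pair_priestley.
- by move=> A clA; rewrite imE.
- by move=> U [[oU _] _]; rewrite imE.
- move=> U [[_ cU] incU]; rewrite imE.
  (* The complement of an increasing set is already decreasing, so [mk5] never tests a clopen set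
     containing [q] but not [p]. *)
  suff -> : down_set (one_strict_pair p q) (~` U) = ~` U by exact: closed_openC.
  apply/seteqP; split=> x.
    by case=> y nUy Rxy Ux; apply: nUy; exact: incU Ux Rxy.
  by move=> nUx; exists x => //; left.
Qed.

Lemma one_strict_pair_not_paK (X : topologicalType) (p q : X)
    (E : set (X * X)) :
  zero_dimensional X -> p != q -> ~ open [set p] ->
  ~ paK_frame (one_strict_pair p q) E.
Proof.
move=> zX pq np [_ _ _ [_ _ _ preR] _ _]; apply: np.
have [|A [clA Aq nAp]] := zX q p; first by rewrite eq_sym.
have [oP _] := preR A clA.
suff -> : [set p] = rel_preimage (one_strict_pair p q) A `&` ~` A.
  by apply: openI => //; case: (clopenC_clopen clA).
rewrite rel_preimageP; apply/seteqP; split=> x.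
  by move=> ->; split=> //; exists q => //; right.
by case=> -[y Ay [/= ->|[-> _]]].
Qed.

Theorem theorem3p2 :
  (forall (X : topologicalType) (R E : set (X * X)),
     paK_frame R E -> mk_frame R E)
  /\ (forall (X1 X2 : topologicalType) (R1 E1 : set (X1 * X1))
        (R2 E2 : set (X2 * X2)) (f : X1 -> X2),
        paK_frame R1 E1 -> paK_frame R2 E2 ->
        paK_function R1 E1 R2 E2 f -> mk_function R1 E1 R2 E2 f)
  /\ ~ (forall (X : topologicalType) (R E : set (X * X)),
          mk_frame R E -> paK_frame R E).
Proof.
split; first exact: paK_frame_mk_frame.
split.
  move=> X1 X2 R1 E1 R2 E2 f _ fX2.
  exact: paK_function_mk_function (paK_poset fX2).
move=> mk_paK.
pose p : cantor_space := fun=> false; pose q : cantor_space := fun=> true.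
have pq : p != q by apply/eqP => /(congr1 (@^~ 0%N)).
have fX := one_strict_pair_mk_frame cantor_space_compact
  cantor_zero_dimensional pq.
apply: (one_strict_pair_not_paK cantor_zero_dimensional pq _
  (mk_paK _ _ _ fX)) => op; have [_ limT] := cantor_perfect.
(* In a perfect space every neighbourhood of [p] contains another point, so the singleton of [p]
   cannot be open. *)
have : limit_point [set: cantor_space] p by rewrite limT.
have np : nbhs p [set p] by apply: open_nbhs_nbhs; split.
by move=> /(_ _ np)[y [/eqP yp _ /yp]].
Qed.
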